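(* Let $\Psi$ be a stationary point process on $\mathbb{R}^d$ with intensity $\alpha\ge 1$. Assume that there exist $c_1>0$ and $\delta>0$ such that $\mathbb{P}(\|\tau(\mathbb{Z}^d,\Psi,0)\|>r)\le c_1e^{-c_1^{-1}r^\delta}$ for all $r\ge 0$. Then there exists $c_3>0$ such that $$\mathbb{P}(r<\|\tau(\mathbb{Z}^d,\Psi^x,x)-x\|<\infty)\le c_3e^{-c_3^{-1}r^\delta},\quad r>0,\ x\in\mathbb{R}^d,$$ where $\Psi^x:=\Psi\cup\{x\}$.
   Context: $\mathbf{N}$ is the space of locally finite subsets $\varphi$ of $\mathbb{R}^d$, with the $\sigma$-field generated by the maps $\varphi\mapsto\varphi(B):=\mathrm{card}(\varphi\cap B)$, $B$ Borel. A point process is a random element of $\mathbf{N}$; it is stationary if $\Psi+x$ has the same distribution as $\Psi$ for all $x\in\mathbb{R}^d$, and then its intensity is $\alpha:=\mathbb{E}\Psi([0,1]^d)$. $\|\cdot\|$ is the Euclidean norm, $\|\infty\|:=\infty$ and $\|\infty-x\|:=\infty$ for $x\in\mathbb{R}^d$. Matching. Let $\varphi,\psi\in\mathbf{N}$. A point $p\in\varphi$ prefers $x\in\psi$ to $y\in\psi$ if $\|x-p\|<\|y-p\|$, or if $\|x-p\|=\|y-p\|$ and $x$ is lexicographically strictly smaller than $y$. A point $x\in\psi$ prefers $p\in\varphi$ to $q\in\varphi$ if $\|p-x\|<\|q-x\|$, or if $\|p-x\|=\|q-x\|$ and $p$ is lexicographically strictly greater than $q$. The mutual nearest neighbour matching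 $\tau(\varphi,\psi,\cdot)$ is defined as follows: put $\varphi_0:=\varphi$, $\psi_0:=\psi$. Given $\varphi_n,\psi_n$, for each pair $(p,x)\in\varphi_n\times\psi_n$ such that $p$ prefers $x$ to all other points of $\psi_n$ and $x$ prefers $p$ to all other points of $\varphi_n$, set $\tau(\varphi,\psi,p):=x$ and $\tau(\varphi,\psi,x):=p$; let $\varphi_{n+1}\subset\varphi_n$, $\psi_{n+1}\subset\psi_n$ be the points not matched in this step. Points of $\varphi_\infty:=\bigcap_n\varphi_n$ and $\psi_\infty:=\bigcap_n\psi_n$ are never matched and get $\tau(\varphi,\psi,x):=\infty$. For $x\notin\varphi\cup\psi$ put $\tau(\varphi,\psi,x):=x$. *)

(* Defs.v *)
From HB Require Import structures.
From mathcomp Require Import all_boot all_order all_algebra.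
From mathcomp Require Import all_classical all_reals all_analysis.
From mathcomp Require Import measurable_realfun.

Set Implicit Arguments.
Unset Strict Implicit.
Unset Printing Implicit Defensive.

Import Order.TTheory GRing.Theory Num.Theory.
Import numFieldNormedType.Exports.

Local Open Scope classical_set_scope.
Local Open Scope ring_scope.

(* The library's norm on 'rV[R]_d is the sup norm, hence a separate Euclidean
   norm. Both induce the same topology and the same bounded sets. *)
Definition enorm (R : realType) (d : nat) (x : 'rV[R]_d) : R :=
  Num.sqrt (\sum_(i < d) x ord0 i ^+ 2).

Definition lexlt (R : realType) (d : nat) (x y : 'rV[R]_d) : Prop :=
  exists i : 'I_d, (forall j : 'I_d, (j < i)%N -> x ord0 j = y ord0 j) /\
                   x ord0 i < y ord0 i.

Definition integer_lattice (R : realType) (d : nat) : set 'rV[R]_d :=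
  [set x | forall i, x ord0 i \is a Num.int].

Definition unit_cube (R : realType) (d : nat) : set 'rV[R]_d :=
  [set x | forall i, 0 <= x ord0 i <= 1].

Definition borel (R : realType) (d : nat) : set (set 'rV[R]_d) := <<s open >>.

Definition locally_finite (R : realType) (d : nat) (A : set 'rV[R]_d) : Prop :=
  forall B : set 'rV[R]_d, bounded_set B -> finite_set (A `&` B).

Record lfset (R : realType) (d : nat) := LFSet {
  lfset_val :> set 'rV[R]_d ;
  lfsetP : locally_finite lfset_val }.

Lemma locally_finite0 (R : realType) (d : nat) :
  locally_finite (set0 : set 'rV[R]_d).
Proof. by move=> B _; rewrite set0I. Qed.

Lemma locally_finite_translate (R : realType) (d : nat) (x : 'rV[R]_d)
    (A : set 'rV[R]_d) :
  locally_finite A -> locally_finite [set y + x | y in A].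
Proof.
move=> lfA B bB.
have bBx : bounded_set [set y | B (y + x)].
  have [M [Mreal MB]] := bB.
  exists (M + `|x|); split; first by rewrite realD.
  move=> N MN y /= By.
  rewrite -(addrK x y) (le_trans (ler_normB _ _))// -lerBrDr.
  by apply: MB By; rewrite ltrBrDr.
apply: (@sub_finite_set _ _ [set y + x | y in A `&` [set y | B (y + x)]]).
  by move=> _ [[y Ay <-] By]; exists y.
exact/finite_image/lfA.
Qed.

HB.instance Definition _ (R : realType) (d : nat) := gen_eqMixin (lfset R d).
HB.instance Definition _ (R : realType) (d : nat) := gen_choiceMixin (lfset R d).
HB.instance Definition _ (R : realType) (d : nat) :=
  isPointed.Build (lfset R d) (LFSet (@locally_finite0 R d)).

Definition point_count (R : realType) (d : nat) (B : set 'rV[R]_d) (phi : lfset R d)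
  : \bar R := counting (phi `&` B).

(* The space N of locally finite sets, with the sigma-algebra generated by the
   counting maps phi |-> phi(B), B Borel. *)
Definition lfset_generators (R : realType) (d : nat) : set (set (lfset R d)) :=
  \bigcup_(B in @borel R d)
    preimage_set_system setT (point_count B) measurable.

Definition lfspace (R : realType) (d : nat) :=
  g_sigma_algebraType (@lfset_generators R d).

Definition translate (R : realType) (d : nat) (x : 'rV[R]_d)
  (phi : lfspace R d) : lfspace R d :=
  LFSet (locally_finite_translate x (@lfsetP R d phi)).

Definition stationary (R : realType) (d : nat) (disp : measure_display)
    (T : measurableType disp) (P : probability T R)
    (Psi : {RV P >-> lfspace R d}) : Prop :=
  forall (x : 'rV[R]_d) (A : set (lfspace R d)), measurable A ->
    pushforward P (translate x \o Psi) A = distribution P Psi A.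

Definition intensity (R : realType) (d : nat) (disp : measure_display)
    (T : measurableType disp) (P : probability T R)
    (Psi : {RV P >-> lfspace R d}) : \bar R :=
  (\int[P]_w point_count (@unit_cube R d) (Psi w))%E.

Section matching.
Variables (R : realType) (d : nat).
Local Notation V := 'rV[R]_d.
Implicit Types (phi psi : set V) (p q x y z : V).

(* Ties are broken in opposite directions on the two sides. *)
Definition phi_prefers p x y : Prop :=
  enorm (x - p) < enorm (y - p) \/
  (enorm (x - p) = enorm (y - p) /\ lexlt x y).

Definition psi_prefers x p q : Prop :=
  enorm (p - x) < enorm (q - x) \/
  (enorm (p - x) = enorm (q - x) /\ lexlt q p).

Definition mutual_nearest phi psi p x : Prop :=
  [/\ phi p, psi x,
      (forall y, psi y -> y <> x -> phi_prefers p x y) &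
      (forall q, phi q -> q <> p -> psi_prefers x p q)].

(* The pair (phi_n, psi_n) of points still unmatched before round n. *)
Fixpoint unmatched phi psi (n : nat) : set V * set V :=
  if n is m.+1 then
    let: (phim, psim) := unmatched phi psi m in
    ([set p | phim p /\ ~ exists x, mutual_nearest phim psim p x],
     [set x | psim x /\ ~ exists p, mutual_nearest phim psim p x])
  else (phi, psi).

Definition matched_at phi psi (n : nat) p x : Prop :=
  mutual_nearest (unmatched phi psi n).1 (unmatched phi psi n).2 p x.

Definition partner phi psi z : set V :=
  [set w | exists n, matched_at phi psi n z w \/ matched_at phi psi n w z].

(* tau(phi, psi, z), with None for the point at infinity. A point has at most
   one partner: this includes z \in phi `&` psi, which is matched with itself
   in round 0. *)
Definition tau phi psi z : option V :=
  xget (if `[< (phi `|` psi) z >] then None else Some z)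
       (Some @` partner phi psi z).

Definition enormy (o : option V) : \bar R :=
  if o is Some v then (enorm v)%:E else +oo%E.

Definition subo (o : option V) x : option V := omap (fun v => v - x) o.

End matching.

(* Main.v *)
(* If x is matched to a lattice point p in tau(Z^d, Psi^x), then in
   tau(Z^d, Psi) the point p is unmatched or has a partner at distance at least
   ||p - x||, since adding x can only improve the situation of p. By
   stationarity each such p at distance s > r contributes at most
   c1 exp(-(s/2)^delta / c1), and summing over the shells
   k <= ||p - x|| < k + 1, which contain O((k + 1)^d) lattice points uniformly
   in x, gives the bound.

   A measure takes arbitrary values on non-measurable sets, so all the events
   involved must be shown measurable. This is done by writing a random locally
   finite set as a countable family of measurable points, each defined on a
   measurable event: the unique point of Psi in a rational ball, on the event
   that there is exactly one. Quantification over Psi then becomes countable,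
   and the unmatched sets of every round inherit such a description. *)

Require Import Defs.
From HB Require Import structures.
From mathcomp Require Import all_boot all_order all_algebra.
From mathcomp Require Import all_classical all_reals all_analysis.
From mathcomp Require Import measurable_realfun.
From mathcomp Require Import ring lra zify.
Import Order.TTheory GRing.Theory Num.Theory.
Import numFieldNormedType.Exports.
Local Open Scope classical_set_scope.
Local Open Scope ring_scope.

Set Implicit Arguments.
Unset Strict Implicit.
Unset Printing Implicit Defensive.

(** * Stable matching *)

Section euclidean_norm.
Context {R : realType} {d : nat}.
Implicit Types (x y z : 'rV[R]_d).

Lemma enorm_ge0 x : 0 <= enorm x.
Proof. exact: sqrtr_ge0. Qed.

Lemma enorm0 : enorm (0 : 'rV[R]_d) = 0.
Proof.
by rewrite /enorm big1 ?sqrtr0// => i _; rewrite mxE expr0n.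
Qed.

Lemma enorm_gt0 x : x != 0 -> 0 < enorm x.
Proof.
move=> x0; rewrite lt_def enorm_ge0 andbT; apply: contra x0.
rewrite sqrtr_eq0 => sum_le0; apply/eqP/rowP => i; rewrite mxE.
have : x ord0 i ^+ 2 <= 0.
  rewrite (le_trans _ sum_le0)// (bigD1 i)//= lerDl sumr_ge0// => j _.
  exact: sqr_ge0.
by rewrite le_eqVlt ltNge sqr_ge0 orbF sqrf_eq0 => /eqP.
Qed.

Lemma enormN x : enorm (- x) = enorm x.
Proof.
by congr Num.sqrt; apply: eq_bigr => i _; rewrite mxE sqrrN.
Qed.

Lemma enormBC x y : enorm (x - y) = enorm (y - x).
Proof. by rewrite -opprB enormN. Qed.

Lemma coord_le_enorm x i : `|x ord0 i| <= enorm x.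
Proof.
rewrite -sqrtr_sqr ler_wsqrtr// (bigD1 i)//= lerDl sumr_ge0// => j _.
exact: sqr_ge0.
Qed.

End euclidean_norm.

Section preferences.
Context {R : realType} {d : nat}.
Implicit Types (p q x y z : 'rV[R]_d).

Lemma lexlt_asym x y : lexlt x y -> ~ lexlt y x.
Proof.
move=> [i [eqi lti]] [j [eqj ltj]].
have [ij|ji|/val_inj ij] := ltngtP i j.
- by move: lti; rewrite eqj// ltxx.
- by move: ltj; rewrite eqi// ltxx.
- by move: ltj; rewrite -ij; apply/negP; rewrite -leNgt ltW.
Qed.

Lemma phi_prefers_asym p x y : phi_prefers p x y -> ~ phi_prefers p y x.
Proof.
move=> [lt1|[eq1 lex1]] [lt2|[eq2 lex2]].
- by move: (lt_trans lt1 lt2); rewrite ltxx.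
- by move: lt1; rewrite eq2 ltxx.
- by move: lt2; rewrite eq1 ltxx.
- exact: (lexlt_asym lex1 lex2).
Qed.

Lemma psi_prefers_asym x p q : psi_prefers x p q -> ~ psi_prefers x q p.
Proof.
move=> [lt1|[eq1 lex1]] [lt2|[eq2 lex2]].
- by move: (lt_trans lt1 lt2); rewrite ltxx.
- by move: lt1; rewrite eq2 ltxx.
- by move: lt2; rewrite eq1 ltxx.
- exact: (lexlt_asym lex1 lex2).
Qed.

Lemma phi_prefers_irr p x : ~ phi_prefers p x x.
Proof. by move=> xx; exact: (phi_prefers_asym xx xx). Qed.

Lemma phi_prefers_self p x : x <> p -> phi_prefers p p x.
Proof.
by move=> xp; left; rewrite subrr enorm0 enorm_gt0// subr_eq0; exact/eqP.
Qed.

Lemma psi_prefers_self x p : p <> x -> psi_prefers x x p.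
Proof.
by move=> px; left; rewrite subrr enorm0 enorm_gt0// subr_eq0; exact/eqP.
Qed.

End preferences.

(** * Rounds, uniqueness of partners, and the effect of adding points *)

Section matching_theory.
Context {R : realType} {d : nat}.
Local Notation V := 'rV[R]_d.
Implicit Types (phi psi : set V) (p q x y z w : V).

Lemma unmatchedS1 phi psi n : (unmatched phi psi n.+1).1 =
  [set p | (unmatched phi psi n).1 p /\ ~ exists x, matched_at phi psi n p x].
Proof. by rewrite /matched_at /=; case: (unmatched _ _ _). Qed.

Lemma unmatchedS2 phi psi n : (unmatched phi psi n.+1).2 =
  [set x | (unmatched phi psi n).2 x /\ ~ exists p, matched_at phi psi n p x].
Proof. by rewrite /matched_at /=; case: (unmatched _ _ _). Qed.

Lemma unmatched_anti1 phi psi m n : (m <= n)%N ->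
  (unmatched phi psi n).1 `<=` (unmatched phi psi m).1.
Proof.
move=> /subnK <-; elim: (n - m)%N => [|k IH] p; first by rewrite add0n.
by rewrite addSn unmatchedS1 => -[/IH].
Qed.

Lemma unmatched_anti2 phi psi m n : (m <= n)%N ->
  (unmatched phi psi n).2 `<=` (unmatched phi psi m).2.
Proof.
move=> /subnK <-; elim: (n - m)%N => [|k IH] p; first by rewrite add0n.
by rewrite addSn unmatchedS2 => -[/IH].
Qed.

Lemma matched_at_mem1 phi psi n p x :
  matched_at phi psi n p x -> (unmatched phi psi n).1 p.
Proof. by case. Qed.

Lemma matched_at_mem2 phi psi n p x :
  matched_at phi psi n p x -> (unmatched phi psi n).2 x.
Proof. by case. Qed.

Lemma matched_at_gone1 phi psi m n p x : (m < n)%N ->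
  matched_at phi psi m p x -> ~ (unmatched phi psi n).1 p.
Proof.
move=> mn px /(unmatched_anti1 mn); rewrite unmatchedS1 => -[_]; apply.
by exists x.
Qed.

Lemma matched_at_gone2 phi psi m n p x : (m < n)%N ->
  matched_at phi psi m p x -> ~ (unmatched phi psi n).2 x.
Proof.
move=> mn px /(unmatched_anti2 mn); rewrite unmatchedS2 => -[_]; apply.
by exists p.
Qed.

Lemma gone_matched1 phi psi n p : phi p -> ~ (unmatched phi psi n).1 p ->
  exists m x, (m < n)%N /\ matched_at phi psi m p x.
Proof.
move=> phip; elim: n => [//|n IH]; rewrite unmatchedS1.
have [pn|/IH[m [x [mn px]]]] := pselect ((unmatched phi psi n).1 p); last first.
  by exists m, x; split=> //; exact: ltnW.
have [[x px] _|npx []//] := pselect (exists x, matched_at phi psi n p x).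
by exists n, x.
Qed.

Lemma gone_matched2 phi psi n x : psi x -> ~ (unmatched phi psi n).2 x ->
  exists m p, (m < n)%N /\ matched_at phi psi m p x.
Proof.
move=> psix; elim: n => [//|n IH]; rewrite unmatchedS2.
have [pn|/IH[m [p [mn px]]]] := pselect ((unmatched phi psi n).2 x); last first.
  by exists m, p; split=> //; exact: ltnW.
have [[p px] _|npx []//] := pselect (exists p, matched_at phi psi n p x).
by exists n, p.
Qed.

(** A matched point leaves after its round, so the two rounds coincide; within one round each of two
    partners would be preferred to the other, against asymmetry. *)
Lemma matched_at_inj2 phi psi m n p x y :
  matched_at phi psi m p x -> matched_at phi psi n p y -> x = y.
Proof.
move=> px py; have [mn|nm|mn] := ltngtP m n.
- by case: (matched_at_gone1 mn px); exact: matched_at_mem1 py.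
- by case: (matched_at_gone1 nm py); exact: matched_at_mem1 px.
- rewrite -mn in py; apply: contrapT => xy.
  have [_ _ prefx _] := px; have [_ _ prefy _] := py.
  apply: (@phi_prefers_asym _ _ p x y).
    by apply: prefx; [exact: matched_at_mem2 py|exact: nesym].
  by apply: prefy xy; exact: matched_at_mem2 px.
Qed.

Lemma matched_at_inj1 phi psi m n p q x :
  matched_at phi psi m p x -> matched_at phi psi n q x -> p = q.
Proof.
move=> px qx; have [mn|nm|mn] := ltngtP m n.
- by case: (matched_at_gone2 mn px); exact: matched_at_mem2 qx.
- by case: (matched_at_gone2 nm qx); exact: matched_at_mem2 px.
- rewrite -mn in qx; apply: contrapT => pq.
  have [_ _ _ prefp] := px; have [_ _ _ prefq] := qx.
  apply: (@psi_prefers_asym _ _ x p q).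
    by apply: prefp; [exact: matched_at_mem1 qx|exact: nesym].
  by apply: prefq pq; exact: matched_at_mem1 px.
Qed.

(** Distance zero beats every other distance. This settles the points lying on both sides of the
    matching. *)
Lemma matched_at_self phi psi z :
  phi z -> psi z -> matched_at phi psi 0 z z.
Proof.
move=> phiz psiz; split=> // y _ yz.
- exact: phi_prefers_self.
- exact: psi_prefers_self.
Qed.

(** [partner] allows [p] on either side of the pair. If [p] occurs on the [psi] side it lies in both
    sets, so it is its own partner and the sides can be exchanged. *)
Lemma partnerP1 phi psi p x : phi p -> partner phi psi p x ->
  exists n, matched_at phi psi n p x.
Proof.
move=> phip [n [px|xp]]; first by exists n.
have psip : psi p := unmatched_anti2 (leq0n n) (matched_at_mem2 xp).
have pp := matched_at_self phip psip.
by rewrite (matched_at_inj1 xp pp); exists 0%N.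
Qed.

Lemma partnerP2 phi psi p x : psi x -> partner phi psi x p ->
  exists n, matched_at phi psi n p x.
Proof.
move=> psix [n [xp|px]]; last by exists n.
have phix : phi x := unmatched_anti1 (leq0n n) (matched_at_mem1 xp).
have xx := matched_at_self phix psix.
by rewrite (matched_at_inj2 xp xx); exists 0%N.
Qed.

Lemma partner_dom phi psi z w : partner phi psi z w -> (phi `|` psi) z.
Proof.
move=> [n [zw|wz]].
- by left; exact: unmatched_anti1 (leq0n n) _ (matched_at_mem1 zw).
- by right; exact: unmatched_anti2 (leq0n n) _ (matched_at_mem2 wz).
Qed.

Lemma partner_inj phi psi z w w' :
  partner phi psi z w -> partner phi psi z w' -> w = w'.
Proof.
move=> zw zw'; have [phiz|psiz] := partner_dom zw.
- have [n zwn] := partnerP1 phiz zw; have [n' zwn'] := partnerP1 phiz zw'.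
  exact: matched_at_inj2 zwn zwn'.
- have [n zwn] := partnerP2 psiz zw; have [n' zwn'] := partnerP2 psiz zw'.
  exact: matched_at_inj1 zwn zwn'.
Qed.

(** Inside the union of [phi] and [psi] the default of [xget] is [None], and uniqueness of partners
    determines the value chosen otherwise. *)
Lemma tauP phi psi z w :
  (phi `|` psi) z -> (tau phi psi z = Some w <-> partner phi psi z w).
Proof.
move=> zdom; rewrite /tau asboolT//; case: xgetP => [u _ [w' zw' w'u]|none].
- by rewrite -w'u; split=> [[<-] //|zw]; rewrite (partner_inj zw zw').
- by split=> // zw; case: (none (Some w)); exists w.
Qed.

(* Suppose p strictly prefers its psi-partner y to its psi'-partner x. Then y
   is matched in psi' before round m, to some q it prefers to p, and q is
   matched in psi before p, to some point it prefers to y: the same situation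
   for q, at an earlier round. *)
Lemma matched_at_mono phi psi psi' m n p x y : psi `<=` psi' ->
  matched_at phi psi' m p x -> matched_at phi psi n p y ->
  ~ phi_prefers p y x.
Proof.
move=> sub; elim/ltn_ind: m n p x y => m IH n p x y px py pyx.
have yx : y <> x by move=> yx; rewrite yx in pyx; exact: phi_prefers_irr pyx.
have psiy : psi y := unmatched_anti2 (leq0n n) (matched_at_mem2 py).
have [] := @gone_matched2 phi psi' m y (sub _ psiy).
  move=> yin; have [_ _ prefx _] := px.
  exact: (phi_prefers_asym pyx (prefx y yin yx)).
move=> m1 [q [m1m qy]].
have pq : p <> q.
  move=> pq; apply: (matched_at_gone1 m1m qy).
  by rewrite -pq; exact: matched_at_mem1 px.
have yqp : psi_prefers y q p.
  have [_ _ _ prefq] := qy; apply: prefq pq.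
  exact: unmatched_anti1 (ltnW m1m) _ (matched_at_mem1 px).
have phiq : phi q := unmatched_anti1 (leq0n m1) (matched_at_mem1 qy).
have [] := @gone_matched1 phi psi n q phiq.
  move=> qin; have [_ _ _ prefp] := py.
  by apply: (psi_prefers_asym yqp); apply: prefp => //; exact: nesym.
move=> n1 [y1 [n1n qy1]].
apply: (IH m1 m1m n1 q y y1 qy qy1).
have [_ _ prefy1 _] := qy1; apply: prefy1.
- exact: unmatched_anti2 (ltnW n1n) _ (matched_at_mem2 py).
- move=> yy1; apply: (matched_at_gone2 n1n qy1); rewrite -yy1.
  exact: matched_at_mem2 py.
Qed.

(** By [matched_at_mono], [p] does not prefer its old partner [y] to the added point [x]; in
    particular [y] is not strictly closer to [p]. *)
Lemma partner_addpoint phi psi x p y :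
  partner phi (psi `|` [set x]) x p -> partner phi psi p y ->
  phi p /\ enorm (p - x) <= enorm (y - p).
Proof.
move=> xp py; have psi'x : (psi `|` [set x]) x by right.
have [m px] := partnerP2 psi'x xp.
have phip : phi p := unmatched_anti1 (leq0n m) (matched_at_mem1 px).
split=> //; have [n {}py] := partnerP1 phip py.
rewrite enormBC leNgt; apply/negP => lt_yx.
by apply: (matched_at_mono (@subsetUl _ psi [set x]) px py); left.
Qed.

(** * Translation equivariance of the matching *)

Let addrKAr t x y : (x + t) - (y + t) = x - y.
Proof. by rewrite opprD addrACA subrr addr0. Qed.

Lemma phi_prefers_translate t p x y :
  phi_prefers (p + t) (x + t) (y + t) <-> phi_prefers p x y.
Proof.
have lexE : lexlt (x + t) (y + t) <-> lexlt x y.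
  split=> -[i [eqi lti]]; exists i; split=> [j /eqi|];
    move: lti; rewrite !mxE.
  - by move=> _; exact: addIr.
  - by rewrite ltrD2r.
  - by move=> _ ->.
  - by rewrite ltrD2r.
by rewrite /phi_prefers lexE !addrKAr.
Qed.

Lemma psi_prefers_translate t x p q :
  psi_prefers (x + t) (p + t) (q + t) <-> psi_prefers x p q.
Proof.
have lexE : lexlt (q + t) (p + t) <-> lexlt q p.
  split=> -[i [eqi lti]]; exists i; split=> [j /eqi|];
    move: lti; rewrite !mxE.
  - by move=> _; exact: addIr.
  - by rewrite ltrD2r.
  - by move=> _ ->.
  - by rewrite ltrD2r.
by rewrite /psi_prefers lexE !addrKAr.
Qed.

(** Preferences involve only differences and the order of coordinates, both unchanged by a common
    shift. The shifted sets are written as preimages, so that membership needs no witness. *)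
Lemma mutual_nearest_translate phi psi t p x :
  mutual_nearest [set y | phi (y + t)] [set y | psi (y + t)] p x <->
  mutual_nearest phi psi (p + t) (x + t).
Proof.
split=> -[phip psix prefx prefp]; split=> //.
- move=> y; rewrite -(subrK t y) => psiy yx.
  by apply/phi_prefers_translate/prefx => // yx'; apply: yx; rewrite yx'.
- move=> q; rewrite -(subrK t q) => phiq qp.
  by apply/psi_prefers_translate/prefp => // qp'; apply: qp; rewrite qp'.
- move=> y psiy yx.
  by apply/(phi_prefers_translate t)/prefx => // /addIr.
- move=> q phiq qp.
  by apply/(psi_prefers_translate t)/prefp => // /addIr.
Qed.

Lemma unmatched_translate phi psi t n :
  unmatched [set y | phi (y + t)] [set y | psi (y + t)] n =
  ([set y | (unmatched phi psi n).1 (y + t)],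
   [set y | (unmatched phi psi n).2 (y + t)]).
Proof.
elim: n => [//|n IH] /=; rewrite IH; case: (unmatched phi psi n) => phin psin.
congr pair; apply/seteqP; split=> y /= [yn nmatch]; split=> // -[z yz];
  apply: nmatch.
- exists (z - t); apply/mutual_nearest_translate; rewrite subrK.
  exact: yz.
- by exists (z + t); apply/mutual_nearest_translate.
- exists (z - t); apply/mutual_nearest_translate; rewrite subrK.
  exact: yz.
- by exists (z + t); apply/mutual_nearest_translate.
Qed.

Lemma matched_at_translate phi psi t n p x :
  matched_at [set y | phi (y + t)] [set y | psi (y + t)] n p x <->
  matched_at phi psi n (p + t) (x + t).
Proof. by rewrite /matched_at unmatched_translate mutual_nearest_translate. Qed.

Lemma partner_translate phi psi t z w :
  partner [set y | phi (y + t)] [set y | psi (y + t)] z w <->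
  partner phi psi (z + t) (w + t).
Proof.
by split=> -[n zw]; exists n; move: zw; rewrite !matched_at_translate.
Qed.

End matching_theory.

(** * Measurability of the matching *)

Section measurable_events.
Context {disp : measure_display} {Omega : measurableType disp}.
Implicit Types (A B : Omega -> Prop).

Lemma measurable_not_event A :
  measurable [set w | A w] -> measurable [set w | ~ A w].
Proof. exact: measurableC. Qed.

Lemma measurable_and_event A B : measurable [set w | A w] ->
  measurable [set w | B w] -> measurable [set w | A w /\ B w].
Proof. exact: measurableI. Qed.

Lemma measurable_or_event A B : measurable [set w | A w] ->
  measurable [set w | B w] -> measurable [set w | A w \/ B w].
Proof. exact: measurableU. Qed.

Lemma measurable_imply_event A B : measurable [set w | A w] ->
  measurable [set w | B w] -> measurable [set w | A w -> B w].
Proof.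
move=> mA mB; rewrite (_ : [set w | _] = [set w | ~ A w \/ B w]).
  by apply: measurable_or_event => //; exact: measurable_not_event.
apply/seteqP; split=> w /= => [AB|[nA /nA//|//]].
by have [/AB|] := pselect (A w); [right|left].
Qed.

Lemma measurable_exists_event (I : countType) (A : I -> Omega -> Prop) :
  (forall i, measurable [set w | A i w]) ->
  measurable [set w | exists i, A i w].
Proof.
move=> mA; rewrite (_ : [set w | _] = \bigcup_i [set w | A i w]).
  by apply: countable_bigcupT_measurable => //; exact: countableP.
by apply/seteqP; split=> w /= [i]; [exists i|exists i].
Qed.

Lemma measurable_forall_event (I : countType) (A : I -> Omega -> Prop) :
  (forall i, measurable [set w | A i w]) ->
  measurable [set w | forall i, A i w].
Proof.
move=> mA; rewrite (_ : [set w | _] = [set w | ~ exists i, ~ A i w]).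
  apply: measurable_not_event; apply: measurable_exists_event => i.
  exact: measurable_not_event.
apply/seteqP; split=> w /= H; first by move=> [i]; exact.
by move=> i; apply: contrapT => nA; apply: H; exists i.
Qed.

Lemma measurable_const_event (Q : Prop) : measurable [set _ : Omega | Q].
Proof.
have [q|nq] := pselect Q.
- suff -> : [set _ : Omega | Q] = setT by exact: measurableT.
  by apply/predeqP.
- suff -> : [set _ : Omega | Q] = set0 by exact: measurable0.
  by apply/predeqP.
Qed.

Context {R : realType}.

Lemma measurable_lt_event (f g : Omega -> R) : measurable_fun setT f ->
  measurable_fun setT g -> measurable [set w | f w < g w].
Proof.
move=> mf mg; rewrite -[X in measurable X]setTI.
exact: (measurable_fun_ltr mf mg measurableT (Y := [set true])).
Qed.

Lemma measurable_eq_event (f g : Omega -> R) : measurable_fun setT f ->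
  measurable_fun setT g -> measurable [set w | f w = g w].
Proof.
move=> mf mg.
rewrite (_ : [set w | _] = [set w | ~ (f w < g w) /\ ~ (g w < f w)]).
  by apply: measurable_and_event; apply: measurable_not_event;
    exact: measurable_lt_event.
apply/seteqP; split=> w /=; first by move=> ->; rewrite ltxx.
by move=> [/negP fg /negP gf]; apply/le_anti; rewrite !leNgt fg gf.
Qed.

End measurable_events.

(** * Random sets enumerated by countably many measurable points *)

Section measurable_random_sets.
Context {disp : measure_display} {Omega : measurableType disp}.
Context {R : realType} {d : nat}.
Local Notation V := 'rV[R]_d.
Implicit Types (X Y : Omega -> V) (S phi psi : Omega -> set V).

Definition measurable_vec X :=
  forall j, measurable_fun setT (fun w => X w ord0 j).

(** Measurability is asked along each measurable choice of a point: exactly what is used when the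
    points of an enumeration are substituted. *)
Definition measurable_pred (Q : Omega -> V -> Prop) :=
  forall X, measurable_vec X -> measurable [set w | Q w (X w)].

(** The point [X i] counts only on the event [E i], so the number of points may vary with the
    outcome; repetitions are allowed. *)
Definition measurable_rset S :=
  exists (I : countType) (E : I -> set Omega) (X : I -> Omega -> V),
  [/\ forall i, measurable (E i), forall i, measurable_vec (X i) &
      forall w, S w = [set X i w | i in [set i | E i w]]].

Lemma measurable_vec_cst (v : V) : measurable_vec (fun=> v).
Proof. by move=> j; exact: measurable_cst. Qed.

Lemma measurable_vecB X Y : measurable_vec X -> measurable_vec Y ->
  measurable_vec (fun w => X w - Y w).
Proof.
move=> mX mY j; under eq_fun do rewrite !mxE.
by apply: measurable_funB; [exact: mX|exact: mY].
Qed.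

Lemma measurable_enorm X : measurable_vec X ->
  measurable_fun setT (fun w => enorm (X w)).
Proof.
move=> mX; rewrite /enorm.
have msqrt : measurable_fun setT (@Num.sqrt R).
  by apply: continuous_measurable_fun; exact: sqrt_continuous.
apply: (measurableT_comp msqrt).
by apply: measurable_sum => j; apply: measurable_funX; exact: mX.
Qed.

Lemma measurable_lexlt X Y : measurable_vec X -> measurable_vec Y ->
  measurable [set w | lexlt (X w) (Y w)].
Proof.
move=> mX mY; apply: measurable_exists_event => i.
apply: measurable_and_event; last exact: measurable_lt_event.
apply: measurable_forall_event => j; apply: measurable_imply_event.
  exact: measurable_const_event.
exact: measurable_eq_event.
Qed.

Lemma measurable_eq_vec X Y : measurable_vec X -> measurable_vec Y ->
  measurable [set w | X w = Y w].
Proof.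
move=> mX mY.
rewrite (_ : [set w | _] = [set w | forall j, X w ord0 j = Y w ord0 j]).
  by apply: measurable_forall_event => j; exact: measurable_eq_event.
by apply/seteqP; split=> w /=; [move=> ->|move=> /rowP].
Qed.

Lemma measurable_phi_prefers p x y : measurable_vec p -> measurable_vec x ->
  measurable_vec y -> measurable [set w | phi_prefers (p w) (x w) (y w)].
Proof.
move=> mp mx my.
have mxp : measurable_fun setT (fun w => enorm (x w - p w)).
  by apply: measurable_enorm; exact: measurable_vecB.
have myp : measurable_fun setT (fun w => enorm (y w - p w)).
  by apply: measurable_enorm; exact: measurable_vecB.
apply: measurable_or_event; first exact: measurable_lt_event.
apply: measurable_and_event; first exact: measurable_eq_event.
exact: measurable_lexlt.
Qed.

Lemma measurable_psi_prefers x p q : measurable_vec x -> measurable_vec p ->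
  measurable_vec q -> measurable [set w | psi_prefers (x w) (p w) (q w)].
Proof.
move=> mx mp mq.
have mpx : measurable_fun setT (fun w => enorm (p w - x w)).
  by apply: measurable_enorm; exact: measurable_vecB.
have mqx : measurable_fun setT (fun w => enorm (q w - x w)).
  by apply: measurable_enorm; exact: measurable_vecB.
apply: measurable_or_event; first exact: measurable_lt_event.
apply: measurable_and_event; first exact: measurable_eq_event.
exact: measurable_lexlt.
Qed.

(** The quantifier over an uncountable space becomes a countable union over the indices of the
    enumeration. *)
Lemma measurable_exists_rset S (Q : Omega -> V -> Prop) :
  measurable_rset S -> measurable_pred Q ->
  measurable [set w | exists v, S w v /\ Q w v].
Proof.
move=> [I [E [X [mE mX SE]]]] mQ.
rewrite (_ : [set w | _] = [set w | exists i, E i w /\ Q w (X i w)]).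
  apply: measurable_exists_event => i.
  by apply: measurable_and_event; [exact: mE|exact/mQ/mX].
apply/seteqP; split=> w /=; rewrite SE.
- by move=> [_ [[i Ei <-] Qi]]; exists i.
- by move=> [i [Ei Qi]]; exists (X i w); split=> //; exists i.
Qed.

Lemma measurable_forall_rset S (Q : Omega -> V -> Prop) :
  measurable_rset S -> measurable_pred Q ->
  measurable [set w | forall v, S w v -> Q w v].
Proof.
move=> mS mQ.
rewrite (_ : [set w | _] = [set w | ~ exists v, S w v /\ ~ Q w v]).
  apply: measurable_not_event; apply: measurable_exists_rset => // X mX.
  by apply: measurable_not_event; exact: mQ.
apply/seteqP; split=> w /= H; first by move=> [v [/H]].
by move=> v Sv; apply: contrapT => nQ; apply: H; exists v.
Qed.

Lemma measurable_mem_rset S : measurable_rset S -> measurable_pred S.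
Proof.
move=> mS X mX.
rewrite (_ : [set w | _] = [set w | exists v, S w v /\ v = X w]).
  by apply: measurable_exists_rset => // Y mY; exact: measurable_eq_vec.
apply/seteqP; split=> w /=; first by exists (X w).
by move=> [v [Sv <-]].
Qed.

(** The enumerating points are kept and only their events shrink; this is how the enumeration passes
    from one round to the next. *)
Lemma measurable_rset_sub S (Q : Omega -> V -> Prop) :
  measurable_rset S -> measurable_pred Q ->
  measurable_rset (fun w => [set v | S w v /\ Q w v]).
Proof.
move=> [I [E [X [mE mX SE]]]] mQ.
exists I, (fun i => [set w | E i w /\ Q w (X i w)]), X; split=> // [i|w].
  by apply: measurable_and_event; [exact: mE|exact/mQ/mX].
rewrite SE; apply/seteqP; split=> v /=.
- by move=> [[i Ei <-] Qi]; exists i.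
- by move=> [i [Ei Qi] <-]; split=> //; exists i.
Qed.

Lemma measurable_rset_range (I : countType) (f : I -> V) :
  measurable_rset (fun=> range f).
Proof.
exists I, (fun=> setT), (fun i _ => f i); split=> [i|i|w].
- exact: measurableT.
- exact: measurable_vec_cst.
- by apply/seteqP; split=> v [i _ <-]; exists i.
Qed.

Lemma measurable_rsetU1 S X : measurable_rset S -> measurable_vec X ->
  measurable_rset (fun w => S w `|` [set X w]).
Proof.
move=> [I [E [Y [mE mY SE]]]] mX.
exists (option I : countType), (fun o => if o is Some i then E i else setT),
  (fun o => if o is Some i then Y i else X); split=> [[i|]|[i|]|w] //.
rewrite SE; apply/seteqP; split=> v /=.
- by move=> [[i Ei <-]|->]; [exists (Some i)|exists None].
- by move=> [[i|] /= Ei <-]; [left; exists i|right].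
Qed.

Section matching.
Variables (phi psi : Omega -> set V).
Hypotheses (mphi : measurable_rset phi) (mpsi : measurable_rset psi).

Lemma measurable_mutual_nearest p x : measurable_vec p -> measurable_vec x ->
  measurable [set w | mutual_nearest (phi w) (psi w) (p w) (x w)].
Proof.
move=> mp mx.
rewrite (_ : [set w | _] = [set w | (phi w (p w) /\ psi w (x w)) /\
   (forall y, psi w y -> y <> x w -> phi_prefers (p w) (x w) y) /\
   (forall q, phi w q -> q <> p w -> psi_prefers (x w) (p w) q)]); last first.
  by apply/seteqP; split=> w /= [] => [|[] ? ? []]; split.
apply: measurable_and_event; apply: measurable_and_event.
- exact: measurable_mem_rset.
- exact: measurable_mem_rset.
- apply: measurable_forall_rset => // y my; apply: measurable_imply_event.
    by apply: measurable_not_event; exact: measurable_eq_vec.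
  exact: measurable_phi_prefers.
- apply: measurable_forall_rset => // q mq; apply: measurable_imply_event.
    by apply: measurable_not_event; exact: measurable_eq_vec.
  exact: measurable_psi_prefers.
Qed.

End matching.

Lemma measurable_unmatched phi psi n :
  measurable_rset phi -> measurable_rset psi ->
  measurable_rset (fun w => (unmatched (phi w) (psi w) n).1) /\
  measurable_rset (fun w => (unmatched (phi w) (psi w) n).2).
Proof.
move=> mphi mpsi; elim: n => [//|n [IH1 IH2]]; split.
(* A partner of [p] in round [n] lies in the [psi] side of that round, so the existential can be
   restricted to an enumerated random set. *)
- rewrite (_ : (fun w => _) = (fun w => [set p |
    (unmatched (phi w) (psi w) n).1 p /\
    ~ exists x, (unmatched (phi w) (psi w) n).2 x /\
                matched_at (phi w) (psi w) n p x])).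
    apply: measurable_rset_sub => // p mp; apply: measurable_not_event.
    apply: measurable_exists_rset => // x mx.
    exact: (measurable_mutual_nearest IH1 IH2).
  apply/funext => w; rewrite unmatchedS1; apply/seteqP.
  split=> p /= [pn np]; split=> // -[x].
  + by move=> [_ px]; apply: np; exists x.
  + by move=> px; apply: np; exists x; split=> //; exact: matched_at_mem2 px.
- rewrite (_ : (fun w => _) = (fun w => [set x |
    (unmatched (phi w) (psi w) n).2 x /\
    ~ exists p, (unmatched (phi w) (psi w) n).1 p /\
                matched_at (phi w) (psi w) n p x])).
    apply: measurable_rset_sub => // x mx; apply: measurable_not_event.
    apply: measurable_exists_rset => // p mp.
    exact: (measurable_mutual_nearest IH1 IH2).
  apply/funext => w; rewrite unmatchedS2; apply/seteqP.
  split=> x /= [xn nx]; split=> // -[p].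
  + by move=> [_ px]; apply: nx; exists p.
  + by move=> px; apply: nx; exists p; split=> //; exact: matched_at_mem1 px.
Qed.

Lemma measurable_exists_partner phi psi z (Q : Omega -> V -> Prop) :
  measurable_rset phi -> measurable_rset psi -> measurable_vec z ->
  measurable_pred Q ->
  measurable [set w | exists v, partner (phi w) (psi w) (z w) v /\ Q w v].
Proof.
move=> mphi mpsi mz mQ; pose U n w := unmatched (phi w) (psi w) n.
rewrite (_ : [set w | _] = [set w | exists n,
   (exists v, (U n w).2 v /\ (matched_at (phi w) (psi w) n (z w) v /\ Q w v)) \/
   (exists v, (U n w).1 v /\ (matched_at (phi w) (psi w) n v (z w) /\ Q w v))]).
  apply: measurable_exists_event => n.
  have [mU1 mU2] := measurable_unmatched n mphi mpsi.
  apply: measurable_or_event; apply: measurable_exists_rset => // v mv;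
    apply: measurable_and_event; try exact: mQ;
    exact: (measurable_mutual_nearest mU1 mU2).
apply/seteqP; split=> w /=.
- move=> [v [[n [zv|vz]] Qv]]; exists n; [left|right]; exists v.
  + by split=> //; exact: matched_at_mem2 zv.
  + by split=> //; exact: matched_at_mem1 vz.
- move=> [n [[v [_ [zv Qv]]]|[v [_ [vz Qv]]]]]; exists v; split=> //; exists n.
  + by left.
  + by right.
Qed.

Lemma measurable_forall_partner phi psi z (Q : Omega -> V -> Prop) :
  measurable_rset phi -> measurable_rset psi -> measurable_vec z ->
  measurable_pred Q ->
  measurable [set w | forall v, partner (phi w) (psi w) (z w) v -> Q w v].
Proof.
move=> mphi mpsi mz mQ.
rewrite (_ : [set w | _] =
  [set w | ~ exists v, partner (phi w) (psi w) (z w) v /\ ~ Q w v]).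
  apply: measurable_not_event; apply: measurable_exists_partner => // X mX.
  by apply: measurable_not_event; exact: mQ.
apply/seteqP; split=> w /= H; first by move=> [v [/H]].
by move=> v zv; apply: contrapT => nQ; apply: H; exists v.
Qed.

End measurable_random_sets.

(** * Enumerating a locally finite set by measurable points *)

Section lfspace_points.
Context {R : realType} {d : nat}.
Local Notation V := 'rV[R]_d.
Implicit Types (A B U : set V) (psi : lfspace R d).

Lemma counting_eq0 A : (counting A = 0%E :> \bar R) <-> A = set0.
Proof.
rewrite /counting; case: asboolP => [finA|infA]; last first.
  by split=> // A0; case: infA; rewrite A0; exact: finite_set0.
split=> [[/eqP]|->]; last by rewrite fset_set0.
rewrite pnatr_eq0 finmap.cardfs_eq0 => /eqP A0.
by rewrite -(fset_setK finA) A0 set_fset0.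
Qed.

Lemma counting_eq1 A : (counting A = 1%E :> \bar R) <-> exists v, A = [set v].
Proof.
rewrite /counting; case: asboolP => [finA|infA]; last first.
  by split=> // -[v Av]; case: infA; rewrite Av; exact: finite_set1.
split=> [[/eqP]|[v ->]]; last by rewrite fset_set1 finmap.cardfs1.
rewrite pnatr_eq1 => /finmap.cardfs1P[v Av].
by exists v; rewrite -(fset_setK finA) Av set_fset1.
Qed.

Lemma measurable_point_count B : borel B ->
  measurable_fun [set: lfspace R d] (point_count B).
Proof.
by move=> bB _ Y mY; apply: sub_sigma_algebra; exists B => //; exists Y.
Qed.

Lemma measurable_hit B : borel B ->
  measurable [set psi : lfspace R d | lfset_val psi `&` B !=set0].
Proof.
move=> bB; rewrite (_ : mkset _ = ~` (point_count B @^-1` [set 0%E])).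
  apply: measurableC; rewrite -[X in measurable X]setTI.
  by apply: measurable_point_count.
apply/seteqP; split=> psi /=; rewrite /point_count.
- by move=> /set0P/eqP hit /counting_eq0.
- by move=> hit; apply/set0P/eqP => psiB; apply/hit/counting_eq0.
Qed.

Definition isolates U : set (lfspace R d) :=
  [set psi | exists v, lfset_val psi `&` U = [set v]].

Lemma measurable_isolates U : borel U -> measurable (isolates U).
Proof.
move=> bU; rewrite (_ : isolates U = point_count U @^-1` [set 1%E]).
  rewrite -[X in measurable X]setTI; exact: measurable_point_count.
by apply/seteqP; split=> psi /counting_eq1.
Qed.

(** The value 0 off [isolates U] is a placeholder: in the enumeration the point counts only on that
    event. *)
Definition point_in U psi : V :=
  if `[< isolates U psi >] then get (lfset_val psi `&` U) else 0.

Lemma point_inE U psi v : lfset_val psi `&` U = [set v] -> point_in U psi = v.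
Proof.
move=> psiU; rewrite /point_in asboolT; last by exists v.
by rewrite psiU; have : [set v] (get [set v]) by apply: getPex; exists v.
Qed.

Lemma open_coord_gt (j : 'I_d) (a : R) : open [set v : V | a < v ord0 j].
Proof.
rewrite (_ : [set v | _] = (fun v : V => v ord0 j) @^-1` [set t | t > a]) //.
apply: open_comp; last exact: open_gt.
by move=> v _; exact: coord_continuous.
Qed.

(** Where [U] isolates a point, its coordinate exceeds [a] exactly when [psi] hits the part of [U]
    with coordinate above [a], an event of the counting maps. Elsewhere the default 0 decides. Open
    half-lines generate the Borel sets. *)
Lemma measurable_point_in U : open U -> measurable_vec (point_in U).
Proof.
move=> oU j; apply: (measurability _ (RGenOInfty.measurableE R)).
move=> _ [_ [a ->] <-]; rewrite setTI.
rewrite (_ : _ @^-1` _ = [set psi |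
    (isolates U psi /\
     lfset_val psi `&` (U `&` [set v : V | a < v ord0 j]) !=set0) \/
    (~ isolates U psi /\ a < 0)]).
  have mU : measurable (isolates U).
    by apply: measurable_isolates; exact: sub_sigma_algebra.
  apply: measurable_or_event; apply: measurable_and_event.
  - exact: mU.
  - apply: measurable_hit; apply: sub_sigma_algebra; apply: openI => //.
    exact: open_coord_gt.
  - exact: measurable_not_event.
  - exact: measurable_const_event.
apply/seteqP; split=> psi /=; rewrite in_itv/= andbT.
- have [[v psiU]|nU] := pselect (isolates U psi).
    rewrite (point_inE psiU) => av; left; split; first by exists v.
    by exists v; rewrite setIA psiU.
  by rewrite /point_in asboolF// mxE; right.
- move=> [[[v psiU]]|[nU]]; last by rewrite /point_in asboolF// mxE.
  by rewrite setIA psiU (point_inE psiU) => -[_ [-> ]].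
Qed.

Definition rat_ball (c : 'rV[rat]_d) (k : nat) : set V :=
  ball (map_mx ratr c : V) k.+1%:R^-1.

Lemma open_rat_ball c k : open (rat_ball c k).
Proof. exact: ball_open. Qed.

Lemma ex_rat_ball (v : V) (e : R) : 0 < e ->
  exists c k, rat_ball c k v /\ rat_ball c k `<=` ball v e.
Proof.
(* With radius below [e / 2], every point of a ball containing [v] is within [e] of [v]. *)
move=> e0; have [k] := @ltr_add_invr R 0 (e / 2) (divr_gt0 e0 (ltr0n _ 2)).
rewrite add0r => ke; have k0 : 0 < k.+1%:R^-1 :> R by rewrite invr_gt0.
have /choice[f fv] : forall j, exists q : rat,
    ball (ratr q : R) k.+1%:R^-1 (v ord0 j).
  move=> j.
  have [] := @rat_in_itvoo R (v ord0 j - k.+1%:R^-1) (v ord0 j + k.+1%:R^-1).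
    by rewrite ltrBlDr -addrA ltrDl addr_gt0.
  move=> q; rewrite in_itv/= => /andP[vq qv]; exists q.
  rewrite -ball_normE /= ltr_norml; apply/andP; split.
    by rewrite ltrBrDr addrC.
  by rewrite ltrBlDr addrC.
have ckv : rat_ball (\row_j f j) k v.
  by split=> // i j; rewrite ord1 !mxE.
exists (\row_j f j), k; split=> // x ckx.
apply: (@le_ball _ _ _ (k.+1%:R^-1 + k.+1%:R^-1)).
  by rewrite [leRHS]splitr lerD ?ltW.
by apply: ball_triangle ckx; exact: ball_sym.
Qed.

(** Only finitely many other points lie in the unit ball around [v]; they form a closed set, whose
    complement is a neighbourhood of [v]. *)
Lemma locally_finite_isolated psi v : lfset_val psi v ->
  exists2 e : R, 0 < e & lfset_val psi `&` ball v e = [set v].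
Proof.
move=> psiv; pose F := (lfset_val psi `&` ball v 1) `\ v.
have finF : finite_set F.
  apply: finite_setD; apply: (@lfsetP _ _ psi).
  exists (`|v| + 1); split; first exact: num_real.
  move=> N vN y; rewrite -ball_normE /= => vy.
  apply/ltW/(le_lt_trans _ vN); rewrite -(subrK v y).
  by rewrite (le_trans (ler_normD _ _))// addrC lerD2l distrC ltW.
have : nbhs v (~` F).
  apply: open_nbhs_nbhs; split; last by move=> [_]; apply.
  apply: closed_openC; move: F finF; apply/accessible_finite_set_closed.
  apply: hausdorff_accessible; exact: norm_hausdorff.
move=> /nbhs_ballP[e /= e0 veF].
exists (Num.min e 1); first by rewrite lt_min e0 ltr01.
apply/seteqP; split=> x /=; last first.
  by move=> ->; split=> //; apply: ballxx; rewrite lt_min e0 ltr01.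
move=> [psix xve]; apply: contrapT => xv.
apply: (veF x); first by apply: le_ball xve; rewrite ge_min lexx.
split=> //; split=> //; apply: le_ball xve; by rewrite ge_min lexx orbT.
Qed.

(** Each point of [psi] is alone in some rational ball, and rational balls are countably many. *)
Lemma measurable_rset_lfspace :
  measurable_rset (fun psi : lfspace R d => lfset_val psi).
Proof.
exists ('rV[rat]_d * nat)%type, (fun c => isolates (rat_ball c.1 c.2)),
  (fun c => point_in (rat_ball c.1 c.2)); split=> [c|c|psi].
- apply: measurable_isolates; apply: sub_sigma_algebra; exact: open_rat_ball.
- by apply: measurable_point_in; exact: open_rat_ball.
apply/seteqP; split=> v /=.
- move=> psiv; have [e e0 psive] := locally_finite_isolated psiv.
  have [c [k [ckv cke]]] := ex_rat_ball v e0.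
  have psick : lfset_val psi `&` rat_ball c k = [set v].
    apply/seteqP; split=> [x [psix /cke vex]|_ -> //].
    by rewrite -psive.
  by exists (c, k); [exists v|exact: point_inE].
- move=> [[c k] [x psick] <-]; rewrite (point_inE psick).
  by have [] : (lfset_val psi `&` rat_ball c k) x by rewrite psick.
Qed.

End lfspace_points.

(** * Matching events for the integer lattice *)

Section integer_lattice.
Context {R : realType} {d : nat}.
Local Notation V := 'rV[R]_d.
Local Notation L := (@integer_lattice R d).
Implicit Types (psi : lfspace R d) (p x v : V).

Definition lattice_point (z : 'rV[int]_d) : V := map_mx intr z.

Lemma integer_latticeE : L = range lattice_point.
Proof.
apply/seteqP; split=> [x xL|_ [z _ <-] i]; last by rewrite mxE intr_int.
exists (\row_i Num.floor (x ord0 i)) => //.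
by apply/rowP => i; rewrite !mxE; apply/eqP; rewrite -intrEfloor.
Qed.

Lemma integer_lattice0 : L 0.
Proof. by move=> i; rewrite mxE. Qed.

Lemma measurable_rset_lattice disp (Omega : measurableType disp) :
  measurable_rset (fun _ : Omega => L).
Proof. rewrite integer_latticeE; exact: measurable_rset_range. Qed.

Lemma integer_lattice_translate p : L p -> [set y | L (y + p)] = L.
Proof.
move=> Lp; apply/seteqP; split=> y /= Ly i.
- by move: (Ly i); rewrite mxE rpredDr// Lp.
- by rewrite mxE rpredD// (Lp, Ly).
Qed.

(** The universal quantifier counts an unmatched [p] as far, in accordance with infinite distance.
    The existential in [added_far_partner] instead excludes an unmatched [x]. *)
Definition far_partner (p : V) (s : R) : set (lfspace R d) :=
  [set psi | forall v, partner L (lfset_val psi) p v -> s < enorm (v - p)].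

Definition added_far_partner (x : V) (r : R) : set (lfspace R d) :=
  [set psi | exists v, partner L (lfset_val psi `|` [set x]) x v /\
                       r < enorm (v - x)].

Lemma measurable_far_partner p s : measurable (far_partner p s).
Proof.
apply: (measurable_forall_partner (psi := fun psi => lfset_val psi)
  (z := fun=> p)) => [||//|X mX].
- exact: measurable_rset_lattice.
- exact: measurable_rset_lfspace.
- apply: measurable_lt_event; first exact: measurable_cst.
  by apply/measurable_enorm/measurable_vecB => //; exact: measurable_vec_cst.
Qed.

Lemma measurable_added_far_partner x r : measurable (added_far_partner x r).
Proof.
apply: (measurable_exists_partner
  (psi := fun psi => lfset_val psi `|` [set x]) (z := fun=> x)) => [||//|X mX].
- exact: measurable_rset_lattice.
- apply: measurable_rsetU1; first exact: measurable_rset_lfspace.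
  exact: measurable_vec_cst.
- apply: measurable_lt_event; first exact: measurable_cst.
  by apply/measurable_enorm/measurable_vecB => //; exact: measurable_vec_cst.
Qed.

Lemma far_partner0E psi s :
  (s%:E < enormy (tau L (lfset_val psi) 0))%E <-> far_partner 0 s psi.
Proof.
have dom0 : (L `|` lfset_val psi) 0 by left; exact: integer_lattice0.
split.
- move=> + v /(tauP _ dom0) tau0; rewrite tau0 /= subr0 lte_fin.
  exact.
- move=> far; case tau0 : (tau _ _ _) => [v|] /=; last exact: ltry.
  by move/(tauP _ dom0): tau0 => /far; rewrite subr0 lte_fin.
Qed.

Lemma added_far_partnerE psi x r :
  (r%:E < enormy (subo (tau L (lfset_val psi `|` [set x]) x) x) < +oo)%E <->
  added_far_partner x r psi.
Proof.
have domx : (L `|` (lfset_val psi `|` [set x])) x by right; right.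
split.
- case taux : (tau _ _ _) => [v|] /=; last by rewrite ltxx andbF.
  by rewrite lte_fin => /andP[rv _]; exists v; split=> //; exact/tauP.
- by move=> [v [/(tauP _ domx) -> rv]]; rewrite /= lte_fin rv ltry.
Qed.

(** The shift by [- p] preserves the lattice and carries [p] to the origin; with stationarity it
    transfers the tail hypothesis to every lattice point. *)
Lemma far_partner_translate p s psi : L p ->
  far_partner 0 s (translate (- p) psi) <-> far_partner p s psi.
Proof.
move=> Lp; rewrite /far_partner /=.
have -> : [set y - p | y in lfset_val psi] = [set y | lfset_val psi (y + p)].
  apply/seteqP; split=> y /=; first by move=> [z psiz <-]; rewrite subrK.
  by move=> psiy; exists (y + p); rewrite ?addrK.
have shift v : partner L [set y | lfset_val psi (y + p)] 0 v <->
    partner L (lfset_val psi) p (v + p).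
  by rewrite -{1}(integer_lattice_translate Lp) partner_translate add0r.
split=> far v.
- by move=> pv; rewrite -[v - p]subr0; apply/far/shift; rewrite subrK.
- by move=> /shift/far; rewrite addrK subr0.
Qed.

(** The witness is the lattice partner of [x]: by [partner_addpoint], any partner it has without [x]
    is at least as far away as [x]. *)
Lemma added_far_partner_sub psi x r : added_far_partner x r psi ->
  exists z, let p := lattice_point z in r < enorm (p - x) /\
  forall s, s < enorm (p - x) -> far_partner p s psi.
Proof.
move=> [p [xp rp]].
have psi'x : (lfset_val psi `|` [set x]) x by right.
have [m px] := partnerP2 psi'x xp.
have : L p := unmatched_anti1 (leq0n m) (matched_at_mem1 px).
rewrite integer_latticeE => -[z _ zp]; exists z; rewrite /= zp; split=> // s sp.
by move=> v /(partner_addpoint xp)[_]; exact: lt_le_trans.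
Qed.

End integer_lattice.

(** * Counting lattice points near an arbitrary centre *)

Section lattice_box.
Context {R : realType} {d : nat}.

(* The index j encodes z_i - floor x_i = j_i - (k + 1), which lies strictly
   between -(k + 1) and k + 2 for lattice points z in the k-th shell. *)
Definition box_index (k : nat) : finType := {ffun 'I_d -> 'I_(2 * k.+2)}.

Definition box_point (x : 'rV[R]_d) k (j : box_index k) : 'rV[int]_d :=
  \row_i (Num.floor (x ord0 i) + (j i)%:Z - k.+1%:Z).

Lemma ex_box_point (x : 'rV[R]_d) k (z : 'rV[int]_d) :
  enorm (lattice_point z - x) < k.+1%:R ->
  exists j : box_index k, z = box_point x j.
Proof.
move=> zx.
(* Coordinates of [z - x] are below [k + 1] in absolute value; replacing [x] by its floor adds a
   number in [0, 1). *)
have zbound i : - k.+1%:Z < z ord0 i - Num.floor (x ord0 i) < k.+2%:Z.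
  have := le_lt_trans (coord_le_enorm _ i) zx; rewrite !mxE ltr_norml.
  move=> /andP[lo hi]; have := floor_le (x ord0 i).
  have := floorD1_gt (x ord0 i); move=> fl1 fl.
  apply/andP; split; rewrite -(ltr_int R).
    rewrite rmorphN rmorphB /= -pmulrn; lra.
  rewrite rmorphB /=; move: fl1; rewrite rmorphD/= -!pmulrn -natr1; lra.
(* The shifted difference lies strictly between 0 and [2k + 3], so [absz] leaves it unchanged. *)
have idx i : (absz (z ord0 i - Num.floor (x ord0 i) + k.+1%:Z)%R < 2 * k.+2)%N.
  by have := zbound i; lia.
exists [ffun i => Ordinal (idx i)]; apply/rowP => i; rewrite !mxE ffunE /=.
rewrite gez0_abs; first by ring.
by have := zbound i; lia.
Qed.

End lattice_box.

(** * The union bound *)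

Section real_bounds.
Context {R : realType}.

Lemma pow_expR_bounded (b delta : R) (m : nat) : 0 < b -> 0 < delta ->
  exists2 K : R, 0 < K &
    forall k : nat, k.+2%:R ^+ m * expR (- (b * k%:R `^ delta)) <= K.
Proof.
(* As [m <= delta * N], for [t >= 1] the power [t ^ m] is at most the [N]-th power of
   [u = t ^ delta]. The inequality [1 + y <= exp y] at [y = b * u / N] bounds [u], and its [N]-th
   power yields [C]. *)
move=> b0 d0; pose N := (Num.truncn (m%:R / delta)).+1.
have N0 : 0 < N%:R :> R by rewrite ltr0n.
have mN : m%:R <= delta * N%:R.
  by rewrite mulrC -ler_pdivrMr// ltW// truncnS_gt.
pose C : R := (N%:R / b) ^+ N.
have C0 : 0 < C by rewrite exprn_gt0// divr_gt0.
exists (2 ^+ m + 3 ^+ m * C).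
  apply: addr_gt0; first by rewrite exprn_gt0.
  by rewrite mulr_gt0// exprn_gt0.
(* At 0 the exponential is 1, leaving [2 ^ m]; from 1 on, [k + 3 <= 3 (k + 1)] reduces to a power of
   [t]. *)
case=> [|k].
  rewrite powR0 ?gt_eqF// mulr0 oppr0 expR0 mulr1 lerDl.
  by rewrite mulr_ge0 ?(ltW C0)// exprn_ge0.
set t := k.+1%:R; have t1 : 1 <= t by rewrite ler1n.
have t0 : 0 <= t by exact: le_trans t1.
set u := t `^ delta; have u0 : 0 <= u by exact: powR_ge0.
have uE : u <= N%:R / b * expR (b * u / N%:R).
  rewrite -ler_pdivrMl ?divr_gt0// invf_div.
  rewrite (le_trans _ (expR_ge1Dx _))// mulrAC.
  by rewrite lerDr.
have tm : t ^+ m <= C * expR (b * u).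
  rewrite -powR_mulrn// (le_trans (ler_powR t1 mN))// powRrM powR_mulrn//.
  rewrite -/u (_ : b * u = N%:R * (b * u / N%:R)); last first.
    by rewrite [RHS]mulrC divfK// gt_eqF.
  rewrite expRM_natl -exprMn lerXn2r// nnegrE mulr_ge0 ?expR_ge0//.
  by rewrite divr_ge0 ?(ltW b0).
have kt : k.+3%:R ^+ m <= 3 ^+ m * t ^+ m.
  rewrite -exprMn lerXn2r ?nnegrE ?mulr_ge0//.
  by rewrite /t -natrM ler_nat; lia.
rewrite (@le_trans _ _ (3 ^+ m * C))//; last by rewrite lerDr exprn_ge0.
rewrite expRN ler_pdivrMr ?expR_gt0// (le_trans kt)// -mulrA.
by rewrite ler_wpM2l// exprn_ge0.
Qed.

(** Telescoping: each term is [1/(k+1) - 1/(k+2)]. This series dominates the sum over the shells. *)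
Lemma sum_inv_consecutive (n : nat) :
  \sum_(0 <= k < n) (k.+1%:R * k.+2%:R)^-1 <= 1 :> R.
Proof.
suff -> : \sum_(0 <= k < n) (k.+1%:R * k.+2%:R)^-1 = 1 - n.+1%:R^-1 :> R.
  by rewrite gerBl invr_ge0.
elim: n => [|n IH]; first by rewrite big_nil invr1 subrr.
rewrite big_nat_recr//= IH.
have n1 : n.+1%:R != 0 :> R by rewrite pnatr_eq0.
have n2 : n.+2%:R != 0 :> R by rewrite pnatr_eq0.
move: n1 n2; rewrite -(natr1 n.+1); move: (n.+1%:R) => t t0 t1.
by field; rewrite t0 t1.
Qed.

Lemma nneseries_inv_consecutive (M : R) : 0 <= M ->
  (\sum_(0 <= k <oo) (M * (k.+1%:R * k.+2%:R)^-1)%:E <= M%:E)%E.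
Proof.
move=> M0; apply: lime_le.
  by apply: is_cvg_nneseries => k _ _; rewrite lee_fin mulr_ge0.
near=> n; rewrite sumEFin lee_fin -mulr_sumr ler_piMr//.
exact: sum_inv_consecutive.
Unshelve. all: by end_near. Qed.

Lemma measure_bigsetU_le disp (T : measurableType disp)
    (mu : {measure set T -> \bar R}) (I : finType) (C : pred I)
    (F : I -> set T) (M : R) : 0 <= M ->
  (forall i, measurable (F i)) -> (forall i, C i -> (mu (F i) <= M%:E)%E) ->
  (mu (\big[setU/set0]_(i | C i) F i) <= (#|I|%:R * M)%:E)%E.
Proof.
move=> M0 mF muF.
apply: (@le_trans _ _ (\sum_(i | C i) M%:E)%E); last first.
  rewrite sumEFin lee_fin sumr_const mulr_natl ler_wpMn2l//.
  exact: max_card.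
suff [] : measurable (\big[setU/set0]_(i | C i) F i) /\
    (mu (\big[setU/set0]_(i | C i) F i) <= \sum_(i | C i) M%:E)%E by [].
(* Measurability is carried through the induction because subadditivity for two sets asks for it. *)
apply: (big_ind2 (fun A y => measurable A /\ (mu A <= y)%E)).
- by rewrite measure0; split; [exact: measurable0|].
- move=> A y B z [mA Ay] [mB Bz]; split; first exact: measurableU.
  exact: le_trans (measureU2 mu mA mB) (leeD Ay Bz).
- by move=> i Ci; split; [exact: mF|exact: muF].
Qed.

End real_bounds.

(** * Stationarity and summation over the shells *)

Theorem theorem5p6 (R : realType) (d : nat) (disp : measure_display)
  (T : measurableType disp) (P : probability T R)
  (Psi : {RV P >-> lfspace R d})
  (Psi_stationary : stationary Psi)
  (Psi_intensity : (1 <= intensity Psi)%E)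
  (c1 delta : R) (c1_gt0 : 0 < c1) (delta_gt0 : 0 < delta)
  (tail : forall r : R, 0 <= r ->
    (P [set w | r%:E < enormy (tau (@integer_lattice R d) (Psi w) 0)]
     <= (c1 * expR (- (c1^-1 * r `^ delta)))%:E)%E) :
  exists c3 : R, 0 < c3 /\
    forall (r : R) (x : 'rV[R]_d), 0 < r ->
      (P [set w | r%:E < enormy (subo (tau (@integer_lattice R d)
                                          (Psi w `|` [set x]) x) x) < +oo]
       <= (c3 * expR (- (c3^-1 * r `^ delta)))%:E)%E.
Proof.
have mPsi A : measurable A -> measurable (Psi @^-1` A).
  move=> mA; rewrite -[X in measurable X]setTI.
  exact: (measurable_funPT Psi).
have far_tail z s : 0 <= s ->
    (P (Psi @^-1` far_partner (lattice_point z) s) <=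
     (c1 * expR (- (c1^-1 * s `^ delta)))%:E)%E.
  move=> s0; apply: le_trans (tail s s0).
  have Lz : @integer_lattice R d (lattice_point z).
    by rewrite integer_latticeE; exists z.
  have := Psi_stationary (- lattice_point z) _ (measurable_far_partner 0 s).
  rewrite /distribution /pushforward => statP.
  have -> : Psi @^-1` far_partner (lattice_point z) s =
      (translate (- lattice_point z) \o Psi) @^-1` far_partner 0 s.
    by apply/seteqP; split=> w /=; rewrite far_partner_translate.
  rewrite statP le_eqVlt; apply/orP; left; apply/eqP; congr (P _).
  by apply/seteqP; split=> w /far_partner0E.
(* Chosen so that the exponent at distance [s / 2] is [2 b s ^ delta]: one half gives the decay in
   [r], the other the decay in the shell number [k]. *)
pose b := c1^-1 * 2^-1 `^ delta / 2.
have b0 : 0 < b by rewrite !mulr_gt0 ?invr_gt0 ?powR_gt0.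
(* Of the [d + 2] powers, [d] absorb the size of the box and two leave the summable factor
   [1/((k+1)(k+2))]. *)
have [K K0 Kbound] := pow_expR_bounded d.+2 b0 delta_gt0.
pose C := c1 * 2 ^+ d * K.
have C0 : 0 < C by rewrite !mulr_gt0 ?exprn_gt0.
have split_exponent r k s : 0 <= r -> r <= s -> 0 <= k -> k <= s ->
    b * r `^ delta + b * k `^ delta <= c1^-1 * (s / 2) `^ delta.
  move=> r0 rs k0 ks; have s0 : 0 <= s by exact: le_trans rs.
  have -> : c1^-1 * (s / 2) `^ delta = b * (s `^ delta + s `^ delta).
    by rewrite powRM// /b; field; rewrite gt_eqF.
  rewrite -mulrDr ler_wpM2l ?(ltW b0)//.
  by rewrite lerD// ge0_ler_powR// ltW.
(* This constant is at least [C], as the prefactor demands, and its inverse is at most [b], as the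
   exponent demands. *)
exists (b^-1 + C); split=> [|r x r0]; first by rewrite addr_gt0 ?invr_gt0.
rewrite [X in P X](_ : _ = Psi @^-1` added_far_partner x r); last first.
  by apply/seteqP; split=> w /added_far_partnerE.
pose dist k (j : box_index k) := enorm (lattice_point (box_point x j) - x).
(* [added_far_partner_sub] gives every threshold strictly below the distance; half the distance is
   one, the distance being positive. *)
pose F k (j : @box_index d k) :=
  Psi @^-1` far_partner (lattice_point (box_point x j)) (dist k j / 2).
pose G k :=
  \big[setU/set0]_(j | (r < dist k j) && (k%:R <= dist k j)) F k j.
have mF k j : measurable (F k j) by apply: mPsi; exact: measurable_far_partner.
have mG k : measurable (G k) by apply: bigsetU_measurable.
pose M := C * expR (- (b * r `^ delta)).
have M0 : 0 <= M by rewrite mulr_ge0 ?expR_ge0// ltW.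
have PG k : (P (G k) <= (M * (k.+1%:R * k.+2%:R)^-1)%:E)%E.
  pose e := c1 * (expR (- (b * r `^ delta)) * expR (- (b * k%:R `^ delta))).
  have e0 : 0 <= e by rewrite mulr_ge0 ?(ltW c1_gt0) ?mulr_ge0 ?expR_ge0.
  apply: (@le_trans _ _ (#|@box_index d k|%:R * e)%:E).
    apply: measure_bigsetU_le => // j /andP[/ltW rj kj].
    apply: le_trans (far_tail _ _ _) _; first by rewrite divr_ge0 ?enorm_ge0.
    rewrite lee_fin (ler_pM2l c1_gt0) -expRD ler_expR -opprD lerN2.
    by apply: split_exponent => //; exact: ltW.
  rewrite lee_fin card_ffun !card_ord natrX natrM exprMn /e /M /C.
  have : k.+2%:R ^+ d * expR (- (b * k%:R `^ delta)) <= K / (k.+1%:R * k.+2%:R).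
    rewrite ler_pdivlMr ?mulr_gt0//; apply: le_trans (Kbound k).
    rewrite -[d.+2]addn2 exprD mulrAC ler_wpM2r ?expR_ge0//.
    rewrite ler_wpM2l ?exprn_ge0//.
    by rewrite expr2 ler_wpM2r// ler_nat.
  set A := k.+2%:R ^+ d; set E1 := expR (- (b * r `^ delta)).
  set E2 := expR _; set Q := k.+1%:R * k.+2%:R => AE2.
  rewrite [leLHS](_ : _ = c1 * 2 ^+ d * E1 * (A * E2)); last by ring.
  rewrite [leRHS](_ : _ = c1 * 2 ^+ d * E1 * (K / Q)); last by ring.
  by rewrite ler_wpM2l// !mulr_ge0 ?exprn_ge0 ?expR_ge0// ltW.
apply: (@le_trans _ _ M%:E).
  apply: le_trans (measure_sigma_subadditive P mG _ _) _.
  - by apply: mPsi; exact: measurable_added_far_partner.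
  - move=> w /added_far_partner_sub[z /= [rz far]].
    (* The integer part of the distance selects the shell, and [ex_box_point] places [z] in its
       box. *)
    pose k := Num.truncn (enorm (lattice_point z - x)).
    have /andP[kz zk] := truncn_itv (enorm_ge0 (lattice_point z - x)).
    have [j zj] := ex_box_point zk.
    exists k => //; rewrite /G (bigD1 j); last by rewrite /dist -zj rz.
    left; rewrite /F /dist -zj; apply: far.
    by rewrite ltr_pdivrMr// mulr_natr mulr2n ltrDl (lt_trans r0 rz).
  - apply: le_trans (nneseries_inv_consecutive M0).
    apply: lee_nneseries => [k _ _|k _]; [exact: measure_ge0|exact: PG].
rewrite lee_fin /M ler_pM ?expR_ge0 ?(ltW C0)//.
  by rewrite lerDr invr_ge0 ltW.
rewrite ler_expR lerN2 ler_wpM2r ?powR_ge0//.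
rewrite -[leRHS]invrK lef_pV2 ?posrE ?invr_gt0 ?addr_gt0 ?invr_gt0//.
by rewrite lerDl ltW.
Qed.
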